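(* Let $\lambda$ be a constant. The adjoint equation of the Nikiforov–Uvarov–Suslov difference equation $$\tilde\sigma[x(z)]\,\Delta_{-1}\nabla_0y(z)+\tfrac12\tilde\tau[x(z)]\big[\Delta_0y(z)+\nabla_0y(z)\big]+\lambda y(z)=0,$$ namely $$\tilde\sigma_{-2}(z+1)\,\Delta_{-1}\nabla_{0}w(z)-\tfrac12\tau_{-2}(z+1)\big[\Delta_{0}w(z)+\nabla_{0}w(z)\big]+(\lambda-\kappa_{-1})\,w(z)=0,$$ is also a difference equation of hypergeometric type on non-uniform lattices; that is, $\tilde\sigma_{-2}(z+1)$ and $-\tau_{-2}(z+1)$ are polynomials of degree at most two and at most one, respectively, in $x(z)$, and $\lambda-\kappa_{-1}$ is a constant.
   Context: Lattice and differences. $x(s)$, $s\in\mathbb C$, is a non-uniform lattice: either $x(s)=c_1q^s+c_2q^{-s}+c_3$ with $c_1c_2\ne0$ ($q\neq0,1$ fixed, with a fixed value of $\log q$ and $q^s=e^{s\log q}$), or $x(s)=\tilde c_1s^2+\tilde c_2s+\tilde c_3$ with $\tilde c_1\tilde c_2\neq0$. For real $\eta$, $x_\eta(s)=x(s+\frac{\eta}{2})$. $\Delta f(s)=f(s+1)-f(s)$, $\nabla f(s)=f(s)-f(s-1)$, $\Delta_\eta f(s)=\Delta f(s)/\Delta x_\eta(s)$, $\nabla_\eta f(s)=\nabla f(s)/\nabla x_\eta(s)$. All equations are considered at points where the denominators do not vanish. Coefficients. $\tilde\sigma[x]$ and $\tilde\tau[x]$ are polynomials in $x$ of degrees at most two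 and one; $\tau(z)=\tilde\tau[x(z)]$ and $\sigma(z)=\tilde\sigma[x(z)]-\frac12\tilde\tau[x(z)]\nabla x_1(z)$. For real $\eta$, $\tau_\eta$ and $\tilde\sigma_\eta$ are defined by $\tau_\eta(z)\nabla x_{\eta+1}(z)=\sigma(z+\eta)-\sigma(z)+\tau(z+\eta)\nabla x_1(z+\eta)$ and $\tilde\sigma_\eta(z)=\sigma(z)+\frac12\tau_\eta(z)\nabla x_{\eta+1}(z)$. Put $\alpha(\eta)=\frac{q^{\eta/2}+q^{-\eta/2}}2$, $\gamma(\eta)=\frac{q^{\eta/2}-q^{-\eta/2}}{q^{1/2}-q^{-1/2}}$ in the $q$-case and $\alpha(\eta)=1$, $\gamma(\eta)=\eta$ in the quadratic case, and $\kappa_\eta=\alpha(\eta-1)\tilde\tau'+\frac12\gamma(\eta-1)\tilde\sigma''$ (derivatives with respect to $x$), so that $\tau_\eta(z)-\kappa_{2\eta+1}x_\eta(z)$ is constant in $z$. Adjoint. The equation can equivalently be written $L[y]=\sigma(z)\Delta_{-1}\nabla_0y(z)+\tau(z)\Delta_0y(z)+\lambda y(z)=0$. Its adjoint equation is $L^{*}[w]=\sigma^{*}(z)\Delta_{-1}\nabla_0w(z)+\tau^{*}(z)\Delta_0w(z)+\lambda^{*}w(z)=0$ with $\sigma^{*}(z)=\sigma(z-1)+\tau(z-1)\nabla x_{-1}(z)$, $\tau^{*}(z)=\frac{\sigma(z+1)-\sigma(z-1)-\tau(z-1)\nabla x_{-1}(z)}{\Delta x_{-1}(z)}$, $\lambda^{*}=\lambda-\frac{\Delta}{\Delta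 x_{-1}(z)}\Big(\frac{\tau(z-1)\nabla x_{-1}(z)-\nabla\sigma(z)}{\nabla x(z)}\Big)$. *)

(* Defs.v *)
From HB Require Import structures.
From mathcomp Require Import all_boot all_order all_algebra.
From mathcomp Require Import ring.
From mathcomp Require Import reals sequences exp trigo.
From mathcomp Require Export complex.

Set Implicit Arguments.
Unset Strict Implicit.
Unset Printing Implicit Defensive.

Import Order.TTheory GRing.Theory Num.Theory.
Local Open Scope ring_scope.
Local Open Scope complex_scope.

Definition cexp (R : realType) (z : R[i]) : R[i] :=
  let: a +i* b := z in (expR a)%:C * (cos b +i* sin b).

(* [QLattice q logq c1 c2 c3] is c1 q^s + c2 q^(-s) + c3, where [logq] is the
   fixed value of log q, so that q^s means cexp (s * logq);
   [QuadLattice c1 c2 c3] is c1 s^2 + c2 s + c3. *)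
Inductive lattice (R : realType) : Type :=
| QLattice of R[i] & R[i] & R[i] & R[i] & R[i]
| QuadLattice of R[i] & R[i] & R[i].

Definition nonuniform (R : realType) (l : lattice R) : Prop :=
  match l with
  | QLattice q logq c1 c2 c3 =>
      [/\ q != 0, q != 1, cexp logq = q & c1 * c2 != 0]
  | QuadLattice c1 c2 c3 => c1 * c2 != 0
  end.

Definition lat (R : realType) (l : lattice R) (s : R[i]) : R[i] :=
  match l with
  | QLattice q logq c1 c2 c3 =>
      c1 * cexp (s * logq) + c2 * cexp (- s * logq) + c3
  | QuadLattice c1 c2 c3 => c1 * s ^+ 2 + c2 * s + c3
  end.

Definition lat_sh (R : realType) (l : lattice R) (eta : R) (s : R[i]) : R[i] :=
  lat l (s + (eta / 2)%:C).

Definition Delta (R : realType) (f : R[i] -> R[i]) (s : R[i]) : R[i] :=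
  f (s + 1) - f s.
Definition nabla (R : realType) (f : R[i] -> R[i]) (s : R[i]) : R[i] :=
  f s - f (s - 1).

(* Division by 0 gives 0 here: the quotients below are meaningful only where
   the denominators are nonzero. *)
Definition DeltaX (R : realType) (l : lattice R) (eta : R)
    (f : R[i] -> R[i]) (s : R[i]) : R[i] :=
  Delta f s / Delta (lat_sh l eta) s.
Definition nablaX (R : realType) (l : lattice R) (eta : R)
    (f : R[i] -> R[i]) (s : R[i]) : R[i] :=
  nabla f s / nabla (lat_sh l eta) s.

Definition alpha (R : realType) (l : lattice R) (eta : R) : R[i] :=
  match l with
  | QLattice q logq c1 c2 c3 =>
      (cexp ((eta / 2)%:C * logq) + cexp (- (eta / 2)%:C * logq)) / 2
  | QuadLattice c1 c2 c3 => 1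
  end.

Definition gamma (R : realType) (l : lattice R) (eta : R) : R[i] :=
  match l with
  | QLattice q logq c1 c2 c3 =>
      (cexp ((eta / 2)%:C * logq) - cexp (- (eta / 2)%:C * logq)) /
      (cexp ((1 / 2)%:C * logq) - cexp (- (1 / 2)%:C * logq))
  | QuadLattice c1 c2 c3 => eta%:C
  end.

Section Coefficients.
Variables (R : realType) (l : lattice R).
(* tilde sigma and tilde tau, as polynomials in x *)
Variables (st tt : {poly R[i]}).

Definition tau (z : R[i]) : R[i] := tt.[lat l z].
Definition sigma (z : R[i]) : R[i] :=
  st.[lat l z] - 1 / 2 * tt.[lat l z] * nabla (lat_sh l 1) z.

Definition tau_ (eta : R) (z : R[i]) : R[i] :=
  (sigma (z + eta%:C) - sigma z
   + tau (z + eta%:C) * nabla (lat_sh l 1) (z + eta%:C))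
  / nabla (lat_sh l (eta + 1)) z.

Definition tsigma_ (eta : R) (z : R[i]) : R[i] :=
  sigma z + 1 / 2 * tau_ eta z * nabla (lat_sh l (eta + 1)) z.

(* For deg st <= 2 and deg tt <= 1, the derivatives tt' and st'' are constant
   polynomials, identified here with their constant coefficients. *)
Definition kappa (eta : R) : R[i] :=
  alpha l (eta - 1) * (tt^`())`_0 + 1 / 2 * gamma l (eta - 1) * (st^`(2))`_0.

Definition sigma_star (z : R[i]) : R[i] :=
  sigma (z - 1) + tau (z - 1) * nabla (lat_sh l (-1)) z.

Definition tau_star (z : R[i]) : R[i] :=
  (sigma (z + 1) - sigma (z - 1) - tau (z - 1) * nabla (lat_sh l (-1)) z)
  / Delta (lat_sh l (-1)) z.

Definition lambda_star (lam : R[i]) (z : R[i]) : R[i] :=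
  lam - DeltaX l (-1)
    (fun s => (tau (s - 1) * nabla (lat_sh l (-1)) s - nabla sigma s)
              / nabla (lat l) s) z.

End Coefficients.

Definition nus_op (R : realType) (l : lattice R) (s t : R[i] -> R[i])
    (lam : R[i]) (y : R[i] -> R[i]) (z : R[i]) : R[i] :=
  s z * DeltaX l (-1) (nablaX l 0 y) z
  + 1 / 2 * t z * (DeltaX l 0 y z + nablaX l 0 y z) + lam * y z.

Definition forward_op (R : realType) (l : lattice R) (s t lam : R[i] -> R[i])
    (y : R[i] -> R[i]) (z : R[i]) : R[i] :=
  s z * DeltaX l (-1) (nablaX l 0 y) z + t z * DeltaX l 0 y z + lam z * y z.

Definition adjoint_op (R : realType) (l : lattice R) (st tt : {poly R[i]})
    (lam : R[i]) : (R[i] -> R[i]) -> R[i] -> R[i] :=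
  forward_op l (sigma_star l st tt) (tau_star l st tt)
    (lambda_star l st tt lam).

(* The denominators occurring at z in the operators above: note that
   Delta_{-1} nabla_0 involves nabla x both at z and at z + 1, and
   nabla x (z + 1) = Delta x z. *)
Definition regular (R : realType) (l : lattice R) (z : R[i]) : Prop :=
  [/\ Delta (lat l) z != 0, nabla (lat l) z != 0
    & Delta (lat_sh l (-1)) z != 0].

(* The equation whose adjoint is taken is the Nikiforov-Uvarov-Suslov one:
   its operator is L, written with sigma and tau. *)
Lemma nus_op_forward (R : realType) (l : lattice R) (st tt : {poly R[i]})
    (lam : R[i]) (y : R[i] -> R[i]) (z : R[i]) : regular l z ->
  nus_op l (fun s => st.[lat l s]) (fun s => tt.[lat l s]) lam y z =
  forward_op l (sigma l st tt) (tau l tt) (fun=> lam) y z.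
Proof.
case=> _ _ hm.
have e0 s : lat_sh l 0 s = lat l s by rewrite /lat_sh mul0r addr0.
have e1 : nabla (lat_sh l 1) z = Delta (lat_sh l (-1)) z.
  have h : (1 : R[i]) + (-1 / 2 : R)%:C = (1 / 2 : R)%:C.
    rewrite -[1 in LHS](rmorph1 (real_complex R)) -rmorphD /=; congr (_%:C).
    by rewrite {1}(splitr (1 : R)) mulN1r mul1r addrK.
  have h' : (-1 : R[i]) + (1 / 2 : R)%:C = (-1 / 2 : R)%:C.
    by rewrite -h addrA addNr add0r.
  by rewrite /nabla /Delta /lat_sh -!addrA h h'.
have e2 : DeltaX l (-1) (nablaX l 0 y) z * nabla (lat_sh l 1) z
          = DeltaX l 0 y z - nablaX l 0 y z.
  rewrite e1 /DeltaX mulfVK // /Delta {1}/nablaX /nabla !e0.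
  by rewrite addrK.
rewrite /nus_op /forward_op /sigma /tau; congr (_ + _).
set a := DeltaX l 0 y z in e2 *; set b := nablaX l 0 y z in e2 *.
have -> : b = a - DeltaX l (-1) (nablaX l 0 y) z * nabla (lat_sh l 1) z.
  by rewrite e2; ring.
by field.
Qed.

(* Main.v *)
Require Import Defs.
From mathcomp Require Import all_boot all_order all_algebra.
From mathcomp Require Import ring.
From mathcomp Require Import reals exp trigo.

(** Every non-uniform lattice satisfies, with constants [a], [b], [J],

      x(s + 1/2) + x(s - 1/2) = a x(s) + b,
      x(s + 1/2)^2 + x(s)^2 - a x(s) x(s + 1/2) - b (x(s) + x(s + 1/2)) = J,

    where [a] is q^(1/2) + q^(-1/2) or 2: consecutive half-step values lie on
    a fixed symmetric conic ([nonuniform_conic]). This is all that the theorem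
    needs to know about the lattice, and it treats both kinds at once.

    Unfolding the definitions gives tau_{-2}(z+1) = - tau^*(z), and

      tsigma_{-2}(z+1) = sigma^*(z) + (1/2) tau^*(z) Delta x_{-1}(z).

    Since Delta_{-1} nabla_0 w times Delta x_{-1} is Delta_0 w - nabla_0 w, this
    correction of sigma^* is exactly what turns tau^* Delta_0 into the mean of
    tau^* Delta_0 and tau^* nabla_0. The second-order and first-order terms of
    the two forms of the adjoint therefore agree for any lattice.

    Write x, u, v for x(z), x(z + 1/2), x(z - 1/2). The recurrence expresses
    x(z +- 1) and x(z +- 3/2) in these.
    - lambda^*: the function whose difference quotient is lambda - lambda^* is
      affine in x(z - 1/2), with slope kappa_{-1} ([lambda_potentialE]).
    - tau^*: its numerator is antisymmetric under the exchange of u and v,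
      hence divisible by its denominator u - v; the quotient is affine in
      u + v = a x + b and in x.
    - tsigma_{-2}(z+1): it is symmetric in u and v, so it is a polynomial in x,
      u + v and u v; the conic says u v = x^2 - b x - J, and the degrees add up
      to at most two. *)

Set Implicit Arguments.
Unset Strict Implicit.
Unset Printing Implicit Defensive.

Import Order.TTheory GRing.Theory Num.Theory.
Local Open Scope ring_scope.
Local Open Scope complex_scope.

(** * The complex exponential *)

Section ComplexExponential.
Variable R : realType.
Implicit Types x y : R[i].

Lemma cexpD x y : cexp (x + y) = cexp x * cexp y.
Proof.
case: x y => [a b] [c d] /=; rewrite expRD cosD sinD.
by simpc; congr (_ +i* _); ring.
Qed.

Lemma cexp0 : cexp (0 : R[i]) = 1.
Proof. by rewrite /= expR0 cos0 sin0; simpc. Qed.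

Lemma cexpN x : cexp (- x) = (cexp x)^-1.
Proof.
have e : cexp x * cexp (- x) = 1 by rewrite -cexpD subrr cexp0.
have nz : cexp x != 0.
  by apply/eqP => x0; move/eqP: e; rewrite x0 mul0r eq_sym oner_eq0.
by apply: (mulfI nz); rewrite e divff.
Qed.

Lemma cexp_neq0 x : cexp x != 0.
Proof.
apply/eqP => x0; have /eqP := cexp0.
by rewrite -(subrr x) cexpD x0 mul0r eq_sym oner_eq0.
Qed.

End ComplexExponential.


Local Notation half := ((1 / 2)%:C).

(** * Half steps on a non-uniform lattice *)

Section HalfSteps.
Variable R : realType.
Implicit Types s : R[i].

Lemma half_add_half : half + half = 1 :> R[i].
Proof. by rewrite -rmorphD /= -splitr. Qed.

Lemma halfE : half = 1 / 2 :> R[i].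
Proof. by rewrite rmorphM fmorphV /= rmorph1 rmorphMn /= rmorph1. Qed.

Lemma addr1_half s : s + 1 = s + half + half.
Proof. by rewrite -addrA half_add_half. Qed.

Lemma subr1_half s : s - 1 = s - half - half.
Proof. by rewrite -half_add_half opprD addrA. Qed.

End HalfSteps.

(** For fixed [lat l s] the second equation is a quadratic equation of which
    [lat l (s + half)] and [lat l (s - half)] are the two roots, by Vieta and
    the first equation. The first equation alone makes [J] invariant under
    half steps only; the content is that it does not depend on [s] at all. *)
Definition lattice_conic (R : realType) (l : lattice R) (a b J : R[i]) : Prop :=
  (forall s, lat l (s + half) + lat l (s - half) = a * lat l s + b) /\
  (forall s, lat l (s + half) ^+ 2 + lat l s ^+ 2
     - a * lat l s * lat l (s + half) - b * (lat l s + lat l (s + half)) = J).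

(** In the q-case put e = q^(1/2) and a = e + 1/e. The recurrence says that
    q^s and q^(-s) are both eigenfunctions, for the eigenvalue a, of the sum of
    the two half shifts; in the conic the squares of q^s and q^(-s) cancel
    because e is a root of X^2 - a X + 1. The condition q <> 1 says that
    the denominator e - 1/e of [gamma] is nonzero. The values at -1 - 1 are those
    occurring in kappa_{-1}. *)
Lemma nonuniform_conic (R : realType) (l : lattice R) :
  nonuniform l -> exists a b J,
  [/\ lattice_conic l a b J, alpha l (-1 - 1) = a ^+ 2 / 2 - 1
    & gamma l (-1 - 1) = - a].
Proof.
have hm : ((-1 - 1) / 2 : R)%:C = - (half + half).
  rewrite half_add_half -(rmorph1 (real_complex R)) -rmorphN.
  by congr (_%:C); field.
case: l => [q logq c1 c2 c3 | c1 c2 c3] /=.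
- case=> _ q1 eq_q _.
  set e := cexp (half * logq); have e0 : e != 0 by exact: cexp_neq0.
  have eNlog : cexp (- half * logq) = e^-1 by rewrite mulNr cexpN.
  have ee : e * e = q by rewrite -cexpD -mulrDl half_add_half mul1r.
  have d0 : e * e - 1 != 0 by rewrite ee subr_eq0.
  have tD s : cexp ((s + half) * logq) = cexp (s * logq) * e.
    by rewrite mulrDl cexpD.
  have tB s : cexp ((s - half) * logq) = cexp (s * logq) * e^-1.
    by rewrite mulrDl cexpD eNlog.
  have eq2 : cexp (((-1 - 1) / 2)%:C * logq) = (e * e)^-1.
    by rewrite hm mulNr cexpN mulrDl cexpD.
  (* [J] is the value of the form for c3 = 0, namely c1 c2 (4 - a^2), corrected
     by the translation by c3. *)
  exists (e + e^-1), ((2 - (e + e^-1)) * c3),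
    (c1 * c2 * (4 - (e + e^-1) ^+ 2) - (2 - (e + e^-1)) * c3 ^+ 2).
  rewrite ?mulNr ?cexpN eq2 -/e; split; last 2 first.
  + by field; rewrite e0.
  + by field; rewrite d0 e0.
  split=> s; have t0 := cexp_neq0 (s * logq);
    rewrite /= !mulNr !cexpN tD ?tB; field; by rewrite e0 t0.
(* Here b is the second difference of x with step 1/2, and [J] is read off at
   s = 0. *)
- move=> _; exists 2, (c1 / 2), (c2 ^+ 2 / 4 - c1 ^+ 2 / 16 - c1 * c3).
  split; first split=> s; rewrite /= ?halfE; by field.
Qed.

(** * The two forms of the operator *)

Section ShiftedDifferences.
Variables (R : realType) (l : lattice R).

Lemma lat_sh0 s : lat_sh l 0 s = lat l s.
Proof. by rewrite /lat_sh mul0r addr0. Qed.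

Lemma lat_sh1 s : lat_sh l 1 s = lat l (s + half).
Proof. by []. Qed.

Lemma lat_shN1 s : lat_sh l (-1) s = lat l (s - half).
Proof. by rewrite /lat_sh mulNr rmorphN. Qed.

Lemma nabla_lat_sh1 s :
  nabla (lat_sh l 1) s = lat l (s + half) - lat l (s - half).
Proof. by rewrite /nabla !lat_sh1 subr1_half subrK. Qed.

Lemma Delta_lat_shN1 s :
  Delta (lat_sh l (-1)) s = lat l (s + half) - lat l (s - half).
Proof. by rewrite /Delta !lat_shN1 addr1_half addrK. Qed.

Lemma nabla_lat_shN1 s :
  nabla (lat_sh l (-1)) s = nabla (lat_sh l 1) (s - 1).
Proof.
rewrite nabla_lat_sh1 /nabla !lat_shN1.
by have -> : s - 1 + half = s - half by rewrite subr1_half subrK.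
Qed.

Lemma nabla_lat_shN1_add1 s :
  nabla (lat_sh l (-1)) (s + 1) = Delta (lat_sh l (-1)) s.
Proof. by rewrite /nabla addrK. Qed.

(** With D = Delta x_{-1}(z), the identity
    Delta_0 y = (Delta_0 y + nabla_0 y) / 2 + (D / 2) Delta_{-1} nabla_0 y
    moves half of the first-order term into the second-order one. *)
Lemma forward_op_nus (s t lam : R[i] -> R[i]) y z : regular l z ->
  forward_op l s t lam y z =
  nus_op l (fun z => s z + 1 / 2 * t z * Delta (lat_sh l (-1)) z) t (lam z) y z.
Proof.
case=> _ _ D0; rewrite /forward_op /nus_op.
set D := Delta (lat_sh l (-1)) z in D0 *.
set F := DeltaX l 0 y z; set B := nablaX l 0 y z.
have -> : DeltaX l (-1) (nablaX l 0 y) z = (F - B) / D.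
  congr (_ / _); rewrite /Delta {1}/nablaX /nabla !lat_sh0 addrK.
  by rewrite /F /DeltaX /Delta !lat_sh0.
by field.
Qed.

End ShiftedDifferences.

Section Adjoint.
Variables (R : realType) (l : lattice R) (st tt : {poly R[i]}).

Lemma sub2_add1 : (-2 + 1 : R) = -1.
Proof. by ring. Qed.

Lemma add1_sub2 (z : R[i]) : z + 1 + (-2)%:C = z - 1.
Proof. by rewrite rmorphN /= rmorphMn /= rmorph1; ring. Qed.

(** The shift -2 makes [tau_] compare the points z - 1 and z + 1, which are the
    points that enter [tau_star], over the same denominator. *)
Lemma tau_N2 z : tau_ l st tt (-2) (z + 1) = - tau_star l st tt z.
Proof.
rewrite /tau_ /tau_star sub2_add1 add1_sub2 nabla_lat_shN1_add1.
by rewrite -nabla_lat_shN1 -mulNr; congr (_ / _); ring.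
Qed.

Lemma tsigma_N2 z : Delta (lat_sh l (-1)) z != 0 ->
  tsigma_ l st tt (-2) (z + 1) =
  sigma_star l st tt z + 1 / 2 * tau_star l st tt z * Delta (lat_sh l (-1)) z.
Proof.
move=> D0; rewrite /tsigma_ tau_N2 sub2_add1 nabla_lat_shN1_add1.
by rewrite /tau_star /sigma_star; field.
Qed.

End Adjoint.

(** * Coefficients of the adjoint as polynomials in x *)

Section LowDegree.
Variable R : nzRingType.
Implicit Type p : {poly R}.

Lemma horner_affine p x : (size p <= 2)%N -> p.[x] = p`_0 + p`_1 * x.
Proof.
move=> hp; rewrite (horner_coef_wide x hp) !big_ord_recl big_ord0 /=.
by rewrite expr0 mulr1 addr0.
Qed.

Lemma horner_quadratic p x :
  (size p <= 3)%N -> p.[x] = p`_0 + p`_1 * x + p`_2 * x ^+ 2.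
Proof.
move=> hp; rewrite (horner_coef_wide x hp) !big_ord_recl big_ord0 /=.
by rewrite expr0 mulr1 addr0 !addrA.
Qed.

End LowDegree.

Section HypergeometricType.
Variables (R : realType) (l : lattice R) (st tt : {poly R[i]}).
Hypotheses (hst : (size st <= 3)%N) (htt : (size tt <= 2)%N).
Variables a b J : R[i].
Hypothesis conic : lattice_conic l a b J.

Lemma lat_subhalf s : lat l (s - half) = a * lat l s + b - lat l (s + half).
Proof. by case: conic => rec _; rewrite -rec addrAC subrr add0r. Qed.

Lemma lat_addhalf s : lat l (s + half) = a * lat l s + b - lat l (s - half).
Proof. by rewrite lat_subhalf; ring. Qed.

Lemma lat_add1 s : lat l (s + 1) = a * lat l (s + half) + b - lat l s.
Proof. by rewrite addr1_half lat_addhalf addrK. Qed.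

Lemma lat_sub1 s : lat l (s - 1) = a * lat l (s - half) + b - lat l s.
Proof. by rewrite subr1_half lat_subhalf subrK. Qed.

Lemma nabla_lat_sh1_add1 s : nabla (lat_sh l 1) (s + 1) =
  a * lat l (s + 1) + b - 2 * lat l (s + half).
Proof.
rewrite nabla_lat_sh1 lat_addhalf.
have -> : s + 1 - half = s + half by rewrite addr1_half addrK.
by ring.
Qed.

Lemma nabla_lat_sh1_sub1 s : nabla (lat_sh l 1) (s - 1) =
  2 * lat l (s - half) - a * lat l (s - 1) - b.
Proof.
rewrite nabla_lat_sh1 lat_subhalf.
have -> : s - 1 + half = s - half by rewrite subr1_half subrK.
by ring.
Qed.

(** Minus [DeltaX l (-1)] of this function is what the adjoint adds to
    [lam]. *)
Definition lambda_potential s :=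
  (tau l tt (s - 1) * nabla (lat_sh l (-1)) s - nabla (sigma l st tt) s)
  / nabla (lat l) s.

(** By the recurrence around s - 1/2, x(s) + x(s - 1) = a y + b with
    y = x(s - 1/2). The numerator is antisymmetric in x(s) and x(s - 1), so
    it is divisible by their difference; the quotient is affine in that
    sum and y, hence in y. *)
Lemma lambda_potentialE s : nabla (lat l) s != 0 ->
  lambda_potential s =
  (tt`_1 * (a ^+ 2 / 2 - 1) - a * st`_2) * lat l (s - half)
  + (1 / 2 * (a * tt`_0 + tt`_1 * (a * b + b)) - st`_1 - b * st`_2).
Proof.
rewrite /lambda_potential nabla_lat_shN1 nabla_lat_sh1_sub1 /nabla => D0.
rewrite /sigma /tau nabla_lat_sh1_sub1 nabla_lat_sh1.
rewrite !(horner_affine _ htt) !(horner_quadratic _ hst).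
rewrite (lat_addhalf s); move: D0; rewrite lat_sub1.
set y := lat l (s - half); set x := lat l s => D0.
by field.
Qed.

Lemma lambda_starE lam z : regular l z ->
  lambda_star l st tt lam z = lam - (tt`_1 * (a ^+ 2 / 2 - 1) - a * st`_2).
Proof.
case=> DX0 NX0 D0; rewrite /lambda_star -/lambda_potential /DeltaX.
congr (_ - _).
apply: (mulIf D0).
rewrite mulfVK // {1}/Delta !lambda_potentialE //; last first.
  by rewrite /nabla addrK.
by rewrite Delta_lat_shN1 addr1_half addrK; ring.
Qed.

Lemma kappaE : kappa l st tt (-1) =
  alpha l (-1 - 1) * tt`_1 + gamma l (-1 - 1) * st`_2.
Proof.
rewrite /kappa coef_deriv coef_derivn mulr1n addn0 ffactnn.
by have -> : 2`! = 2%N by []; field.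
Qed.


(** Dividing the antisymmetric numerator by u - v, with u = x(z + 1/2) and
    v = x(z - 1/2), leaves an affine expression in x, u + v = a x + b
    and x(z + 1) + x(z - 1) = k x + m. *)
Lemma tau_star_poly : exists2 Q : {poly R[i]}, (size Q <= 2)%N &
  forall z, Delta (lat_sh l (-1)) z != 0 -> tau_star l st tt z = Q.[lat l z].
Proof.
pose k := a ^+ 2 - 2; pose m := (a + 2) * b.
pose q0 := a * (st`_1 + m * st`_2)
  - 1 / 2 * (k * tt`_0 + tt`_1 * (a * (a * m + b) - 2 * (a + 1) * b)).
pose q1 := a * k * st`_2 - 1 / 2 * tt`_1 * (a ^+ 2 * k - 2 * a ^+ 2 + 2).
exists (Poly [:: q0; q1]); first exact: size_Poly.
move=> z; rewrite Delta_lat_shN1 => D0.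
rewrite /tau_star Delta_lat_shN1 nabla_lat_shN1 /sigma /tau.
rewrite nabla_lat_sh1_add1 nabla_lat_sh1_sub1 lat_add1 lat_sub1.
rewrite !(horner_affine _ htt) !(horner_quadratic _ hst) horner_Poly /=.
move: D0; rewrite lat_subhalf.
set u := lat l (z + half); set x := lat l z => D0.
by rewrite /q0 /q1 /k /m; field.
Qed.

(** The left-hand side is half of the sum of st at x(z + 1) and x(z - 1), plus
    a quarter of the difference of tt nabla x_1 at z - 1 and z + 1. It is
    symmetric in u = x(z + 1/2) and v = x(z - 1/2), and the conic is what
    eliminates the product u v. *)
Lemma tsigma_star_poly : exists2 P : {poly R[i]}, (size P <= 3)%N &
  forall z, Delta (lat_sh l (-1)) z != 0 ->
  sigma_star l st tt z + 1 / 2 * tau_star l st tt z * Delta (lat_sh l (-1)) z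
  = P.[lat l z].
Proof.
(* For the whole steps X = x(z + 1) and Y = x(z - 1): X + Y = k x + m,
   X Y = x^2 - m x + n and X^2 + Y^2 = r2 x^2 + r1 x + r0. *)
pose k := a ^+ 2 - 2; pose m := (a + 2) * b.
pose n := (a + 1) * b ^+ 2 - a ^+ 2 * J.
pose r0 := m ^+ 2 - 2 * n; pose r1 := 2 * (k + 1) * m; pose r2 := k ^+ 2 - 2.
pose p0 := st`_0 + 1 / 2 * (m * st`_1 + r0 * st`_2) - 1 / 4 * a * m * tt`_0
  + 1 / 4 * tt`_1
    * (2 * a * (b ^+ 2 + 2 * J) + 2 * b ^+ 2 - a * r0 - b * m).
pose p1 := 1 / 2 * (k * st`_1 + r1 * st`_2) + 1 / 4 * a * (2 - k) * tt`_0
  + 1 / 4 * tt`_1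
    * (4 * a * (a + 1) * b + 2 * (a - 1) * b - a * r1 - b * k).
pose p2 := 1 / 2 * r2 * st`_2
  + 1 / 4 * tt`_1 * (2 * a * k - 2 * a - a * r2).
exists (Poly [:: p0; p1; p2]); first exact: size_Poly.
move=> z D0.
rewrite /tau_star /sigma_star nabla_lat_shN1 -mulrA mulfVK // /sigma /tau.
rewrite nabla_lat_sh1_add1 nabla_lat_sh1_sub1 lat_add1 lat_sub1.
rewrite !(horner_affine _ htt) !(horner_quadratic _ hst) horner_Poly /=.
rewrite lat_subhalf.
(* Substituting the conic for J makes the claim an identity between
   polynomials in the independent x and u. *)
case: conic => _ /(_ z).
set u := lat l (z + half); set x := lat l z => eJ.
by rewrite /p0 /p1 /p2 /r0 /r1 /r2 /n /m /k -eJ; field.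
Qed.

End HypergeometricType.

Theorem corollary3p3 (R : realType) (l : lattice R) (hl : nonuniform l)
    (st tt : {poly R[i]}) (hst : (size st <= 3)%N) (htt : (size tt <= 2)%N)
    (lam : R[i]) :
  (forall (w : R[i] -> R[i]) (z : R[i]), regular l z ->
     adjoint_op l st tt lam w z =
     nus_op l (fun s => tsigma_ l st tt (-2) (s + 1))
              (fun s => - tau_ l st tt (-2) (s + 1))
              (lam - kappa l st tt (-1)) w z) /\
  (exists P Q : {poly R[i]},
     [/\ (size P <= 3)%N, (size Q <= 2)%N
       & forall z : R[i], nabla (lat_sh l (-1)) (z + 1) != 0 ->
           tsigma_ l st tt (-2) (z + 1) = P.[lat l z] /\
           - tau_ l st tt (-2) (z + 1) = Q.[lat l z]]).
Proof.
have [a [b [J [conic alphaE gammaE]]]] := nonuniform_conic hl.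
split.
  move=> w z reg; rewrite /adjoint_op forward_op_nus //.
  have [_ _ D0] := reg.
  rewrite /nus_op tsigma_N2 // tau_N2 opprK (lambda_starE hst htt conic) //.
  by rewrite kappaE alphaE gammaE; congr (_ + _ * _); ring.
have [P sP hP] := tsigma_star_poly hst htt conic.
have [Q sQ hQ] := tau_star_poly hst htt conic.
exists P, Q; split=> // z; rewrite nabla_lat_shN1_add1 => D0.
by rewrite tsigma_N2 // tau_N2 opprK hP // hQ.
Qed.
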